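(* Let $A\in\mathbb{R}^{n\times n}$, $B\in\mathbb{R}^{n\times m}$, $C\in\mathbb{R}^{p\times n}$, $L\in\mathbb{R}^{n\times p}$, $Q_y=Q_y^T\ge0$ in $\mathbb{R}^{p\times p}$ and $R=R^T>0$ in $\mathbb{R}^{m\times m}$, and let $M,A_\zeta,B_\zeta$ be the matrices associated with $(A,B,C,L)$ as defined in the context; let $Q_\zeta=M^TC^TQ_yCM$. Suppose $(A_\zeta,B_\zeta)$ is stabilizable and $(A_\zeta,\sqrt{Q_y}\,CM)$ is detectable. Let $P_\zeta^*$ be the unique positive semi-definite solution of $$A_\zeta^TP_\zeta^*+P_\zeta^*A_\zeta+Q_\zeta-P_\zeta^*B_\zeta R^{-1}B_\zeta^TP_\zeta^*=0$$ and $K_\zeta^*=-R^{-1}B_\zeta^TP_\zeta^*$. Let $\bar K_0$ be such that $A_\zeta+B_\zeta\bar K_0$ is Hurwitz, and let $(\bar P_k)_{k\ge0}$, $(\bar K_k)_{k\ge0}$ be generated by Kleinman's algorithm: for $k=0,1,2,\dots$, with $A_\zeta^{k}=A_\zeta+B_\zeta\bar K_k$ (here $k$ is an index, not a power), $$0=(A_\zeta^k)^T\bar P_k+\bar P_kA_\zeta^k+Q_\zeta+\bar K_k^TR\bar K_k,\qquad \bar K_{k+1}=-R^{-1}B_\zeta^T\bar P_k.$$ Then all eigenvalues of $A_\zeta^k$ lie in the open left half-plane for every $k$, $\lim_{k\to\infty}\bar P_k=P_\zeta^*$, and $\lim_{k\to\infty}\bar K_k=K_\zeta^*$.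
   Context: $\sqrt{Q_y}$ is the unique positive semi-definite square root of $Q_y$. Let $\Lambda(s)=\det(sI-A+LC)=s^n+\alpha_{n-1}s^{n-1}+\cdots+\alpha_1 s+\alpha_0$, and let $D_0,\dots,D_{n-1}\in\mathbb{R}^{n\times n}$ be the constant matrices with $(sI-A+LC)^{-1}=\frac{1}{\Lambda(s)}\sum_{j=0}^{n-1}D_js^j$. For $i=1,\dots,m$ let $f_i$ be the $i$-th column of $B$, and for $i=m+1,\dots,m+p$ let $f_i$ be the $(i-m)$-th column of $L$. Set $M_i=[D_0f_i,\dots,D_{n-1}f_i]\in\mathbb{R}^{n\times n}$ and $M=[M_1,\dots,M_{m+p}]\in\mathbb{R}^{n\times(m+p)n}$. Let $\mathcal{A}\in\mathbb{R}^{n\times n}$ be the companion matrix with ones on the first superdiagonal, last row $(-\alpha_0,-\alpha_1,\dots,-\alpha_{n-1})$ and zeros elsewhere, and $b=(0,\dots,0,1)^T\in\mathbb{R}^n$. With $\otimes$ the Kronecker product and $\mathbf{0}$ zero blocks of compatible size, $$A_\zeta=(I_{m+p}\otimes\mathcal{A})+\begin{bmatrix}\mathbf{0}\\ I_p\otimes b\end{bmatrix}CM,\qquad B_\zeta=\begin{bmatrix}I_m\otimes b\\ \mathbf{0}\end{bmatrix},$$ so $A_\zeta$ is $(m+p)n\times(m+p)n$ and $B_\zeta$ is $(m+p)n\times m$. Under the stabilizability and detectability hypotheses, the Riccati equation in the claim is known to have a unique positive semi-definite solution. *)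

(* Defs.v *)
From HB Require Import structures.
From mathcomp Require Import all_boot all_order all_algebra.
From mathcomp Require Import all_classical all_reals all_analysis.
From mathcomp Require Export complex mxtens.

Set Implicit Arguments.
Unset Strict Implicit.
Unset Printing Implicit Defensive.

Import Order.TTheory GRing.Theory Num.Theory.
Import numFieldNormedType.Exports.

Local Open Scope ring_scope.

Section Matrices.
Variable R : realType.

(* No positivity is imposed on the dimensions: an empty matrix is positive
   definite and Hurwitz. *)

Definition psdmx (n : nat) (Q : 'M[R]_n) : Prop :=
  Q^T = Q /\ forall x : 'cV[R]_n, 0 <= (x^T *m Q *m x) 0 0.

Definition pdmx (n : nat) (Q : 'M[R]_n) : Prop :=
  Q^T = Q /\ forall x : 'cV[R]_n, x != 0 -> 0 < (x^T *m Q *m x) 0 0.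

(* At most one [S] satisfies this for a given [Q], and one does iff [Q] is
   positive semi-definite. *)
Definition is_psd_sqrt (n : nat) (Q S : 'M[R]_n) : Prop :=
  psdmx S /\ S *m S = Q.

Definition hurwitz (n : nat) (A : 'M[R]_n) : Prop :=
  forall z : R[i], eigenvalue (map_mx (real_complex R) A) z ->
    complex.Re z < 0.

Definition stabilizable (n m : nat) (A : 'M[R]_n) (B : 'M[R]_(n, m)) : Prop :=
  exists K : 'M[R]_(m, n), hurwitz (A + B *m K).

Definition detectable (n p : nat) (A : 'M[R]_n) (C : 'M[R]_(p, n)) : Prop :=
  exists G : 'M[R]_(n, p), hurwitz (A + G *m C).

Section Observer.
Variables (n m p : nat).
Variables (A : 'M[R]_n) (B : 'M[R]_(n, m)) (C : 'M[R]_(p, n)).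
Variable L : 'M[R]_(n, p).

(* det (s I - A + L C), since s I - A + L C = s I - (A - L C). *)
Definition obs_poly : {poly R} := char_poly (A - L *m C).

(* The resolvent identity at the real points s that are not roots of
   [obs_poly]; there are infinitely many, so it determines [D] and extends to
   all complex s. *)
Definition is_resolvent_coeffs (D : 'I_n -> 'M[R]_n) : Prop :=
  forall s : R, obs_poly.[s] != 0 ->
    invmx (s%:M - A + L *m C) =
      (obs_poly.[s])^-1 *: \sum_(j < n) s ^+ j *: D j.

(* [f_i] is a column of [B] for i < m, then a column of [L]. *)
Definition input_col (i : 'I_(m + p)) : 'cV[R]_n := col i (row_mx B L).

Definition Mblock (D : 'I_n -> 'M[R]_n) (i : 'I_(m + p)) : 'M[R]_n :=
  \matrix_(r, j) (D j *m input_col i) r 0.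

(* Column i * n + j of [Mmx] is column j of block i: the same block indexing
   as the Kronecker product [*t]. *)
Definition Mmx (D : 'I_n -> 'M[R]_n) : 'M[R]_(n, (m + p) * n) :=
  \matrix_(r, c) Mblock D (mxtens_unindex c).1 r (mxtens_unindex c).2.

Lemma obs_poly_degree : (size obs_poly).-1 = n.
Proof. by rewrite size_char_poly. Qed.

Definition companion : 'M[R]_n :=
  castmx (obs_poly_degree, obs_poly_degree) (companionmx obs_poly).

Definition bvec : 'cV[R]_n := \col_(i < n) (i.+1 == n)%:R.

Definition injy : 'M[R]_((m + p) * n, p) :=
  castmx (esym (mulnDl m p n), muln1 p)
    (col_mx (0 : 'M[R]_(m * n, p * 1)) ((1%:M : 'M[R]_p) *t bvec)).

Definition Azeta (D : 'I_n -> 'M[R]_n) : 'M[R]_((m + p) * n) :=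
  (1%:M : 'M[R]_(m + p)) *t companion + injy *m (C *m Mmx D).

Definition Bzeta : 'M[R]_((m + p) * n, m) :=
  castmx (esym (mulnDl m p n), muln1 m)
    (col_mx ((1%:M : 'M[R]_m) *t bvec) (0 : 'M[R]_(p * n, m * 1))).

Definition Qzeta (D : 'I_n -> 'M[R]_n) (Qy : 'M[R]_p) : 'M[R]_((m + p) * n) :=
  (Mmx D)^T *m C^T *m Qy *m C *m Mmx D.

End Observer.

Section LQR.
Variables (N m : nat).
Variables (A : 'M[R]_N) (B : 'M[R]_(N, m)) (Q : 'M[R]_N) (W : 'M[R]_m).

Definition riccati (P : 'M[R]_N) : Prop :=
  A^T *m P + P *m A + Q - P *m B *m invmx W *m B^T *m P = 0.

Definition lqr_gain (P : 'M[R]_N) : 'M[R]_(m, N) := - (invmx W *m B^T *m P).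

Definition kleinman (P : nat -> 'M[R]_N) (K : nat -> 'M[R]_(m, N)) : Prop :=
  forall k : nat,
    0 = (A + B *m K k)^T *m P k + P k *m (A + B *m K k)
        + Q + (K k)^T *m W *m K k
    /\ K k.+1 = lqr_gain (P k).

End LQR.

End Matrices.

(* Main.v *)
Require Import Defs.
From mathcomp Require Import all_boot all_order all_algebra.
From mathcomp Require Import all_classical all_reals all_analysis.
From mathcomp Require Import ring.

Import Order.TTheory GRing.Theory Num.Theory.
Import numFieldNormedType.Exports.

Local Open Scope classical_set_scope.
Local Open Scope ring_scope.

(** The theorem is Kleinman's convergence theorem for an LQR problem (A, B, Q, W)
    in which Q = S^T S and (A, S) is detectable; the special structure of the
    observer matrices enters only through Q = S^T S with S = sqrt(Qy) C M
    ([kleinman_cvg] is the general statement).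

    Policy iteration is Newton's method on the Riccati equation, and the
    identity behind it is a completion of the square ([completing_square]): if
    K' is the gain of P, the Lyapunov expression of P along the closed loop
    A + B K exceeds the one along A + B K' by (K - K')^T W (K - K').  Hence P_k,
    which solves a Lyapunov equation along A + B K_k, also solves one along
    A + B K_(k+1), with one more nonnegative term.  Three facts then suffice.

    - If A is Hurwitz and Q is positive semi-definite, every solution X of
      A^T X + X A + Q = 0 is positive semi-definite ([lyapunov_psd]).  This
      gives P_k >= 0, and P_(k+1) <= P_k by subtracting the two equations along
      A + B K_(k+1).
    - Conversely, a Lyapunov equation with a positive semi-definite solution
      and a source term dominating S^T S + K^T W K forces the closed loop to be
      Hurwitz, by detectability ([detectable_hurwitz]).  So the Hurwitz property
      propagates from K_k to K_(k+1).
    - A Sylvester equation A1^T X + X A2 = 0 with A1 and A2 Hurwitz has only the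
      zero solution ([sylvester_eq0]).  The gap of two stabilizing solutions of
      the Riccati equation satisfies such an equation, so they coincide
      ([stabilizing_riccati_uniq]).

    The P_k decrease and are bounded below by 0, so they converge; the limit is
    positive semi-definite and solves the Riccati equation, hence is stabilizing
    by the second fact, as Pstar is, and equals Pstar by the third.

    The two facts on matrix equations are proved without matrix exponentials.
    After a complex Schur triangularization the Sylvester equation is solved
    entry by entry ([trig_sylvester_eq0]), and the sign of the solution of the
    Lyapunov equation follows by induction on the dimension with a Schur
    complement ([trig_lyapunov]). *)

(** * Matrix equations with triangular coefficients *)

Section TriangularEquations.

Set Implicit Arguments.
Unset Strict Implicit.
Unset Printing Implicit Defensive.

Local Open Scope sesquilinear_scope.

Lemma addmxE (V : zmodType) m n (A B : 'M[V]_(m, n)) i j :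
  (A + B) i j = A i j + B i j.
Proof. by rewrite mxE. Qed.

Lemma oppmxE (V : zmodType) m n (A : 'M[V]_(m, n)) i j : (- A) i j = - A i j.
Proof. by rewrite mxE. Qed.

Variable C : numClosedFieldType.

Lemma trmxC_mul m n p (A : 'M[C]_(m, n)) (B : 'M[C]_(n, p)) :
  (A *m B)^t* = B^t* *m A^t*.
Proof. by rewrite trmx_mul map_mxM. Qed.

Lemma trmxC_add m n (A B : 'M[C]_(m, n)) : (A + B)^t* = A^t* + B^t*.
Proof. by rewrite linearD map_mxD. Qed.

Lemma trmxC_opp m n (A : 'M[C]_(m, n)) : (- A)^t* = - A^t*.
Proof. by rewrite linearN map_mxN. Qed.

Lemma trmxC_block m1 m2 n1 n2 (A : 'M[C]_(m1, n1)) (B : 'M[C]_(m1, n2))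
    (D : 'M[C]_(m2, n1)) (E : 'M[C]_(m2, n2)) :
  (block_mx A B D E)^t* = block_mx (A^t*) (D^t*) (B^t*) (E^t*).
Proof. by rewrite tr_block_mx map_block_mx. Qed.

Lemma trmxC_row m n1 n2 (A : 'M[C]_(m, n1)) (B : 'M[C]_(m, n2)) :
  (row_mx A B)^t* = col_mx (A^t*) (B^t*).
Proof. by rewrite tr_row_mx map_col_mx. Qed.

Lemma unitarymx_adjK n (U : 'M[C]_n) : U \is unitarymx -> U^t* *m U = 1%:M.
Proof. by move=> unU; rewrite -invmx_unitary// mulVmx// unitarymx_unit. Qed.

Definition hform n (Q : 'M[C]_n) (w : 'rV[C]_n) : C := (w *m Q *m w^t*) 0 0.

Lemma hformN n (X : 'M[C]_n) w : hform (- X) w = - hform X w.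
Proof. by rewrite /hform mulmxN mulNmx mxE. Qed.

Lemma hformD n (X Y : 'M[C]_n) w : hform (X + Y) w = hform X w + hform Y w.
Proof. by rewrite /hform mulmxDr mulmxDl mxE. Qed.

Lemma mulmx11 (a b : 'M[C]_1) : (a *m b) 0 0 = a 0 0 * b 0 0.
Proof. by rewrite mxE big_ord1. Qed.

(** The condition a + a^* < 0 says that the real part of a is negative, whereas
    the real part of - b^* is positive. *)
Lemma neg_real_part_add_neq0 (a b : C) :
  a + a^* < 0 -> b + b^* < 0 -> a + b^* != 0.
Proof.
move=> a_lt0 b_lt0; apply/eqP => /eqP; rewrite addr_eq0 => /eqP ab.
move: a_lt0; rewrite ab rmorphN/= conjCK -opprD oppr_lt0 addrC.
by move=> /lt_trans/(_ b_lt0); rewrite ltxx.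
Qed.

(** In position (i, j) only X i j and entries with smaller i + j occur, and the
    coefficient of X i j is the sum of the diagonal entries, which is nonzero;
    so X vanishes by induction on i + j. *)
Lemma trig_sylvester_eq0 n1 n2 (T1 : 'M[C]_n1) (T2 : 'M[C]_n2)
    (X : 'M[C]_(n1, n2)) :
  is_trig_mx T1 -> is_trig_mx T2 ->
  (forall i, T1 i i + (T1 i i)^* < 0) ->
  (forall j, T2 j j + (T2 j j)^* < 0) ->
  T1 *m X + X *m T2^t* = 0 -> X = 0.
Proof.
move=> /is_trig_mxP trig1 /is_trig_mxP trig2 neg1 neg2 eqX.
have: forall s (i : 'I_n1) (j : 'I_n2), (i + j < s)%N -> X i j = 0.
  elim=> // s IHs i j; rewrite ltnS => le_s.
  have /matrixP/(_ i j) := eqX; rewrite !mxE (bigD1 i)//= (bigD1 j)//= !mxE.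
  rewrite [X in _ + X + _]big1 => [|k ki]; last first.
    have [lt_ik|ge_ik] := ltnP i k; first by rewrite trig1// mul0r.
    rewrite IHs ?mulr0//; apply: leq_trans le_s.
    by rewrite ltn_add2r ltn_neqAle ki.
  rewrite [X in _ + (_ + X)]big1 => [|k kj]; last first.
    rewrite !mxE.
    have [lt_jk|ge_jk] := ltnP j k; first by rewrite trig2// rmorph0 mulr0.
    rewrite IHs ?mul0r//; apply: leq_trans le_s.
    by rewrite ltn_add2l ltn_neqAle kj.
  rewrite !addr0 [X i j * _]mulrC -mulrDl => /eqP; rewrite mulf_eq0.
  by rewrite (negPf (neg_real_part_add_neq0 (neg1 i) (neg2 j))) => /eqP.
by move=> X0; apply/matrixP => i j; rewrite mxE; exact: X0 (ltnSn _).
Qed.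

(** In a positive semi-definite matrix a zero diagonal entry kills its row and
    column. *)
Lemma psd_corner_eq0 n (y : 'M[C]_(n, 1)) (X : 'M[C]_n) :
  (forall w, 0 <= hform (block_mx 0 (y^t*) y X : 'M[C]_(1 + n)) w) -> y = 0.
Proof.
move=> psdX.
have c_ge0 : 0 <= hform X (y^t*).
  have := psdX (row_mx 0 (y^t*)); rewrite /hform mul_row_block trmxC_row.
  by rewrite trmx0 map_mx0 mul_row_col !mul0mx !mulmx0 !add0r trmxCK.
set a := (y^t* *m y) 0 0.
have aE : a = \sum_i `|y i 0| ^+ 2.
  by rewrite /a mxE; apply: eq_bigr => i _; rewrite !mxE normCKC.
have a_ge0 : 0 <= a by rewrite aE sumr_ge0// => i _; rewrite exprn_ge0.
set c := hform _ _ in c_ge0.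
(* At (-s, t y^* ) the form is - 2 s t a + t^2 c; the choice s = c + 1, t = a
   makes it - a^2 (c + 2), which can be nonnegative only if a = 0. *)
have := psdX (row_mx (- (c + 1))%:M (a *: y^t*)).
rewrite /hform mul_row_block trmxC_row mul_row_col.
rewrite tr_scalar_mx map_scalar_mx linearZ/= map_mxZ trmxCK mulmx0 add0r.
rewrite -!scalemxAl -!scalemxAr mulmxDl -!scalemxAl !mul_scalar_mx.
rewrite !mul_mx_scalar.
have ya : y^t* *m y = a%:M by exact: mx11_scalar.
have yXy : y^t* *m X *m y = c%:M by rewrite [LHS]mx11_scalar /c /hform trmxCK.
rewrite -scalemxAl ya yXy !mxE/= !mulr1n rmorphN/= rmorphD/= rmorph1.
rewrite (geC0_conj a_ge0) (geC0_conj c_ge0) => form_ge0.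
have : 0 <= - (a ^+ 2 * (c + 2)).
  by apply: le_trans form_ge0 _; rewrite le_eqVlt; apply/orP; left; apply/eqP; ring.
rewrite oppr_ge0 => le0.
have : a ^+ 2 * (c + 2) == 0 by rewrite eq_le le0 mulr_ge0 ?exprn_ge0// addr_ge0.
rewrite mulf_eq0 expf_eq0/= [c + 2 == 0]gt_eqF ?orbF; last by rewrite ltr_wpDl.
rewrite aE psumr_eq0 => [/allP y0|i _]; last exact: exprn_ge0.
apply/matrixP => i j; rewrite (ord1 j) mxE; apply/eqP.
by have := y0 i (mem_index_enum _); rewrite expf_eq0/= normr_eq0.
Qed.

(** Induction on the dimension.  Split off the first coordinate, so that T has
    blocks a, 0, c, T' and X has blocks x, y^*, y, X'.  The corner of the
    equation gives x >= 0.  Moreover y = k x for some k: this is clear if x is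
    nonzero; if x = 0, the corner of the positive semi-definite right-hand side
    vanishes, hence so does its first column, which says T' y + y a^* = 0, and
    y = 0 by the Sylvester case.  Along the vectors (- v k, v), X acts as the
    Schur complement X'' = X' - k y^* on v, so X'' satisfies the same hypotheses
    with T', and X is the sum of a square weighted by x and of X''. *)
Lemma trig_lyapunov n (T X : 'M[C]_n) :
  is_trig_mx T -> (forall i, T i i + (T i i)^* < 0) -> X^t* = X ->
  (forall w, 0 <= hform (- (T *m X + X *m T^t*)) w) ->
  forall w, 0 <= hform X w.
Proof.
elim: n => [|n IHn] in T X *.
  by move=> _ _ _ _ w; rewrite /hform [w]thinmx0 !mul0mx mxE.
move: T X; change n.+1 with (1 + n)%N => T X.
rewrite -[T]submxK -[X]submxK.
move: (ulsubmx T) (ursubmx T) (dlsubmx T) (drsubmx T) => a b c T'.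
move: (ulsubmx X) (ursubmx X) (dlsubmx X) (drsubmx X) => x y' y X'.
rewrite is_trig_block_mx// => /and3P[/eqP-> _ trigT'] diag_lt0.
rewrite trmxC_block => /eq_block_mx[hx <- _ hX'].
move=> psdTX; have := psdTX.
rewrite trmxC_block trmx0 map_mx0 !mulmx_block add_block_mx opp_block_mx.
rewrite !mul0mx !mulmx0 !addr0 => psdM.
have x_real : (x 0 0)^* = x 0 0 by rewrite -{2}hx !mxE.
have diag_a : a 0 0 + (a 0 0)^* < 0.
  by have := diag_lt0 (lshift n 0); rewrite block_mxEul.
have diag_T' i : T' i i + (T' i i)^* < 0.
  by have := diag_lt0 (rshift 1 i); rewrite block_mxEdr.
have x_ge0 : 0 <= x 0 0.
  have := psdM (row_mx 1%:M 0).
  rewrite /hform mul_row_block trmxC_row mul_row_col trmx0 map_mx0 mulmx0 addr0.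
  rewrite trmx1 map_mx1 mulmx1 !mul1mx mul0mx addr0 oppmxE addmxE !mulmx11 !mxE.
  by rewrite [x 0 0 * _]mulrC -mulrDl oppr_ge0 nmulr_rle0.
have [k yE] : exists k : 'M[C]_(n, 1), y = k *m x.
  have [x0|xn0] := eqVneq (x 0 0) 0; last first.
    exists ((x 0 0)^-1 *: y); rewrite {2}[x]mx11_scalar.
    by rewrite mul_mx_scalar scalerA mulfV// scale1r.
  exists 0; rewrite mul0mx.
  have {}x0 : x = 0 by rewrite [x]mx11_scalar x0 raddf0.
  move: psdM; rewrite x0 !mul0mx !mulmx0 !add0r oppr0 => psdM.
  apply: (@trig_sylvester_eq0 _ _ T' a) => //.
  - by rewrite mx11_is_trig.
  - by move=> j; rewrite (ord1 j).
  - apply/eqP; rewrite -oppr_eq0; apply/eqP.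
    pose M' := - (c *m y^t* + T' *m X' + (y *m c^t* + X' *m T'^t*)).
    apply: (@psd_corner_eq0 _ _ M') => w; apply: le_trans (psdM w) _.
    by rewrite trmxC_opp trmxC_add !trmxC_mul trmxCK addrC.
have yCE : y^t* = x *m k^t* by rewrite yE trmxC_mul hx.
pose X'' := X' - k *m y^t*.
have hX'' : X''^t* = X''.
  by rewrite /X'' trmxC_add trmxC_opp trmxC_mul trmxCK hX' yCE yE mulmxA.
have psdX'' v : 0 <= hform X'' v.
  apply: (IHn T') => // {}v.
  set u := row_mx (- (v *m k)) v; set BX := block_mx x _ _ _ in psdTX.
  have uX : u *m BX = row_mx 0 (v *m X'').
    rewrite mul_row_block yE mulNmx mulmxA addNr.
    by rewrite -yE mulNmx /X'' mulmxBr mulmxA addrC.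
  have Xu : BX *m u^t* = col_mx 0 (X'' *m v^t*).
    rewrite trmxC_row mul_block_col trmxC_opp trmxC_mul /X'' mulmxBl yCE yE.
    by rewrite !mulmxN !mulmxA addNr [_ - _]addrC.
  apply: le_trans (psdTX u) _; rewrite le_eqVlt.
  apply/orP; left; apply/eqP; rewrite !hformN; congr (- _).
  rewrite !hformD /hform !mulmxA uX -mulmxA Xu.
  rewrite mul_row_block mul_row_col mulmx0 add0r mulmx0 add0r.
  congr (_ + _); first by rewrite mulmxA.
  rewrite trmxC_block trmxC_row mul_row_block mul_row_col.
  by rewrite trmx0 map_mx0 !mul0mx !mulmx0 !add0r mul0mx add0r.
move=> w; rewrite -[w]hsubmxK; move: (lsubmx w) (rsubmx w) => s v.
have -> : hform (block_mx x (y^t*) y X') (row_mx s v) =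
    ((s + v *m k) *m x *m (s + v *m k)^t*) 0 0 + hform X'' v.
  rewrite /hform mul_row_block trmxC_row mul_row_col -addmxE yCE yE /X''.
  congr (fun_of_matrix _ 0 0).
  rewrite yCE trmxC_add trmxC_mul !mulmxDl !mulmxBr !mulmxDr !mulmxBl !mulmxA.
  by apply/matrixP => i j; rewrite !(addmxE, oppmxE); ring.
by rewrite addr_ge0// !mulmx11 !mxE mulrAC mulr_ge0// mul_conjC_ge0.
Qed.

End TriangularEquations.

(** * Real matrices: definiteness and Hurwitz coefficients *)

Section RealMatrices.

Set Implicit Arguments.
Unset Strict Implicit.
Unset Printing Implicit Defensive.

Local Open Scope sesquilinear_scope.

Variable R : realType.
Local Notation C := R[i].
Local Notation cmx := (map_mx (real_complex R)).

Lemma conjC_real (x : R) : (real_complex R x)^* = real_complex R x.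
Proof. exact: conjc_real. Qed.

Lemma trmxC_cmx m n (A : 'M[R]_(m, n)) : (cmx A)^t* = cmx A^T.
Proof. by apply/matrixP => i j; rewrite !mxE; exact: conjc_real. Qed.

Lemma cmx_inj m n : injective (fun A : 'M[R]_(m, n) => cmx A).
Proof.
move=> A B /matrixP AB; apply/matrixP => i j.
by have := AB i j; rewrite !mxE => /complexI.
Qed.

(** For symmetric Q the mixed terms between the real part a and the imaginary
    part b of the vector cancel. *)
Lemma hform_cmx n (Q : 'M[R]_n) (w : 'rV[C]_n) : Q^T = Q ->
  let a := map_mx (@complex.Re R) w in let b := map_mx (@complex.Im R) w in
  hform (cmx Q) w = real_complex R ((a *m Q *m a^T) 0 0 + (b *m Q *m b^T) 0 0).
Proof.
move=> symQ a b.
have wE : w = cmx a + 'i%C *: cmx b.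
  by apply/matrixP => i j; rewrite !mxE; exact: complexE.
have wCE : w^t* = cmx a^T - 'i%C *: cmx b^T.
  apply/matrixP => i j; rewrite wE !mxE rmorphD rmorphM/= !conjC_real -mulNr.
  by congr (_ + _ * _); apply/eqP; rewrite eq_complex/= oppr0 !eqxx.
have sym : a *m Q *m b^T = b *m Q *m a^T.
  rewrite [LHS]mx11_scalar -[LHS]tr_scalar_mx -mx11_scalar !trmx_mul trmxK symQ.
  by rewrite mulmxA.
rewrite /hform wCE wE !mulmxDl !mulmxBr -!scalemxAl -!scalemxAr -!map_mxM.
rewrite scalerA sym -expr2 sqr_i scaleN1r.
by rewrite !(addmxE, oppmxE) !mxE rmorphD/=; ring.
Qed.

Lemma psd_hform_ge0 n (Q : 'M[R]_n) w : psdmx Q -> 0 <= hform (cmx Q) w.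
Proof.
move=> [symQ psdQ]; rewrite hform_cmx// ler0c.
by apply: addr_ge0; rewrite -[X in X *m Q]trmxK psdQ.
Qed.

Lemma pdmx_psd n (Q : 'M[R]_n) : pdmx Q -> psdmx Q.
Proof.
move=> [symQ pdQ]; split=> // x.
have [->|x0] := eqVneq x 0; last exact: ltW (pdQ _ x0).
by rewrite mulmx0 mxE.
Qed.

Lemma pd_hform_eq0 n (Q : 'M[R]_n) w : pdmx Q -> hform (cmx Q) w = 0 -> w = 0.
Proof.
move=> pdQ; have [symQ psdQ] := pdmx_psd pdQ; rewrite hform_cmx//.
set a := map_mx _ _; set b := map_mx _ _ => /complexI/eqP.
have q_ge0 (u : 'rV_n) : 0 <= (u *m Q *m u^T) 0 0.
  by rewrite -[X in X *m Q]trmxK psdQ.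
have q_eq0 (u : 'rV_n) : (u *m Q *m u^T) 0 0 == 0 -> u = 0.
  move=> q0; apply: contraTeq q0 => u0; rewrite gt_eqF//.
  by rewrite -[X in X *m Q]trmxK; apply: pdQ.2; rewrite trmx_eq0.
rewrite paddr_eq0// => /andP[/q_eq0 a0 /q_eq0 b0].
apply/matrixP => i j; rewrite [LHS]complexE mxE.
have /matrixP/(_ i j) := a0; rewrite !mxE => ->.
have /matrixP/(_ i j) := b0; rewrite !mxE => ->.
by rewrite mulr0 addr0.
Qed.

Lemma pdmx_unit n (W : 'M[R]_n) : pdmx W -> W \in unitmx.
Proof.
move=> [_ pdW]; rewrite -row_free_unit; apply: inj_row_free => v vW.
apply: contraTeq isT => v0; have := pdW v^T; rewrite trmx_eq0 => /(_ v0).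
by rewrite trmxK vW mul0mx mxE ltxx.
Qed.

Lemma pdmx1 n : pdmx (1%:M : 'M[R]_n).
Proof.
split=> [|x x0]; first exact: trmx1.
rewrite mulmx1 lt_neqAle; apply/andP; split; last first.
  by rewrite mxE sumr_ge0// => i _; rewrite mxE -expr2 sqr_ge0.
apply: contraNneq x0 => /esym/eqP.
rewrite mxE psumr_eq0 => [/allP h|i _]; last by rewrite mxE -expr2 sqr_ge0.
apply/eqP/matrixP => i j; rewrite (ord1 j) [RHS]mxE; apply/eqP.
by have := h i (mem_index_enum _); rewrite mxE -expr2 sqrf_eq0.
Qed.

Lemma psdmxD n (X Y : 'M[R]_n) : psdmx X -> psdmx Y -> psdmx (X + Y).
Proof.
move=> [sX pX] [sY pY]; split=> [|x]; first by rewrite linearD/= sX sY.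
by rewrite mulmxDr mulmxDl mxE addr_ge0.
Qed.

Lemma psdmx_congr m n (X : 'M[R]_m) (K : 'M[R]_(m, n)) :
  psdmx X -> psdmx (K^T *m X *m K).
Proof.
move=> [sX pX]; split=> [|x]; first by rewrite !trmx_mul trmxK sX mulmxA.
by have := pX (K *m x); rewrite trmx_mul !mulmxA.
Qed.

Lemma hform_congr m n (X : 'M[R]_m) (K : 'M[R]_(m, n)) w :
  hform (cmx (K^T *m X *m K)) w = hform (cmx X) (w *m cmx K^T).
Proof. by rewrite /hform !map_mxM trmxC_mul trmxC_cmx trmxK !mulmxA. Qed.

Lemma addcJ_lt0 (z : C) : (z + z^* < 0) = (complex.Re z < 0).
Proof.
rewrite [z^*]/(conjc z) addcJ pmulr_rlt0 ?ltr0n//.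
by rewrite -(rmorph0 (real_complex R)) ltcR.
Qed.

Lemma eigenvalue_tr (F : fieldType) n (A : 'M[F]_n) z :
  eigenvalue A^T z = eigenvalue A z.
Proof.
rewrite !eigenvalue_root_char; congr (root _ z); rewrite /char_poly.
by rewrite -det_tr; congr (\det _); apply/matrixP => i j; rewrite !mxE eq_sym.
Qed.

(** Schur triangularization, applied to the transpose so that a Lyapunov
    equation A^T X + X A = - Q becomes T X + X T^* = - Q in the new
    coordinates. *)
Lemma hurwitz_schur n (A : 'M[R]_n) : hurwitz A ->
  exists2 U : 'M[C]_n, U \is unitarymx & exists2 T : 'M[C]_n,
    is_trig_mx T /\ (forall i, T i i + (T i i)^* < 0) &
    cmx A^T = U^t* *m T *m U /\ cmx A = U^t* *m T^t* *m U.
Proof.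
move=> hA.
have [|U unU /=] := @cotrigonalization C n [:: cmx A^T].
  by move=> ? ? /[!inE] /eqP-> /eqP->.
rewrite andbT /similar_to/= conjymx//; set T := _ *m _ => trigT.
have AE : cmx A^T = U^t* *m T *m U.
  have UU := unitarymx_adjK unU.
  by rewrite /T !mulmxA UU mul1mx -mulmxA UU mulmx1.
clearbody T; exists U => //; exists T; last first.
  split=> //.
  by rewrite -[A in LHS]trmxK -trmxC_cmx AE !trmxC_mul trmxCK mulmxA.
split=> // i; rewrite addcJ_lt0; apply: hA; rewrite -eigenvalue_tr map_trmx AE.
have : eigenvalue T (T i i).
  rewrite eigenvalue_root_char char_poly_trig// /root horner_prod (bigD1 i)//=.
  by rewrite hornerXsubC subrr mul0r.
move=> /eigenvalueP[v vT v0]; apply/eigenvalueP; exists (v *m U).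
  by rewrite !mulmxA (mulmxtVK v unU) vT scalemxAl.
by rewrite mulmx_free_eq0// row_free_unit unitarymx_unit.
Qed.

Lemma sylvester_eq0 n1 n2 (A1 : 'M[R]_n1) (A2 : 'M[R]_n2) (X : 'M[R]_(n1, n2)) :
  hurwitz A1 -> hurwitz A2 -> A1^T *m X + X *m A2 = 0 -> X = 0.
Proof.
move=> /hurwitz_schur[U1 unU1 [T1 [trig1 neg1] [A1E _]]].
move=> /hurwitz_schur[U2 unU2 [T2 [trig2 neg2] [_ A2E]]] eqX.
have X'0 : U1 *m cmx X *m U2^t* = 0.
  apply: (trig_sylvester_eq0 trig1 trig2 neg1 neg2).
  have := congr1 (fun Z => U1 *m cmx Z *m U2^t*) eqX.
  rewrite map_mxD !map_mxM A1E A2E map_mx0 mulmx0 mul0mx mulmxDr mulmxDl !mulmxA.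
  by rewrite (unitarymxP unU1) mul1mx mulmxtVK.
apply: cmx_inj => /=; rewrite map_mx0.
have <- : U1^t* *m (U1 *m cmx X *m U2^t*) *m U2 = cmx X.
  by rewrite !mulmxA mulmxKtV// unitarymx_adjK// mul1mx.
by rewrite X'0 mulmx0 mul0mx.
Qed.

(** Symmetry of X is a conclusion: X^T solves the same equation, and solutions
    are unique by [sylvester_eq0]. *)
Lemma lyapunov_psd n (A Q X : 'M[R]_n) : hurwitz A -> psdmx Q ->
  A^T *m X + X *m A + Q = 0 -> psdmx X.
Proof.
move=> hA psdQ eqX.
have symX : X^T = X.
  apply/eqP; rewrite -subr_eq0; apply/eqP; apply: (sylvester_eq0 hA hA).
  have eqXT : X^T *m A + A^T *m X^T + Q = 0.
    by rewrite -trmx0 -eqX !linearD/= !trmx_mul trmxK psdQ.1.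
  transitivity (A^T *m X^T + X^T *m A + Q - (A^T *m X + X *m A + Q)).
    rewrite mulmxBr mulmxBl.
    by apply/matrixP => i j; rewrite !(addmxE, oppmxE); ring.
  by rewrite eqX [A^T *m X^T + _]addrC eqXT subr0.
split=> // x; have [U unU [T [trigT negT] [ATE AE]]] := hurwitz_schur hA.
have UU := unitarymx_adjK unU.
have psdX : forall w, 0 <= hform (U *m cmx X *m U^t*) w.
  apply: (trig_lyapunov trigT negT).
    by rewrite !trmxC_mul trmxCK trmxC_cmx symX mulmxA.
  move=> w; have := psd_hform_ge0 (w *m U) psdQ.
  have -> : Q = - (A^T *m X + X *m A) by apply/eqP; rewrite -addr_eq0 addrC eqX.
  rewrite map_mxN map_mxD !map_mxM ATE AE /hform trmxC_mul !mulmxA.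
  by rewrite !(mulmxN, mulNmx, mulmxDr, mulmxDl) !mulmxA !mulmxtVK.
have := psdX (cmx x^T *m U^t*).
rewrite /hform trmxC_mul trmxCK trmxC_cmx trmxK !mulmxA.
rewrite -[_ *m U^t* *m U]mulmxA UU mulmx1 -[_ *m U^t* *m U]mulmxA UU mulmx1.
by rewrite -!map_mxM mxE ler0c.
Qed.

(** Test the equation on an eigenvector w of the closed loop with eigenvalue z:
    2 Re z (w P w^* ) plus nonnegative terms is zero.  If Re z >= 0 every term
    vanishes, so S and K both kill w.  Then w is an eigenvector of A itself, and
    of A + G S for every G, with the same z, against detectability. *)
Lemma detectable_hurwitz n m p (A : 'M[R]_n) (B : 'M[R]_(n, m))
    (S : 'M[R]_(p, n)) (W : 'M[R]_m) (K : 'M[R]_(m, n)) (P Z : 'M[R]_n) :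
  pdmx W -> detectable A S -> psdmx P -> psdmx Z ->
  (A + B *m K)^T *m P + P *m (A + B *m K) + S^T *m S + K^T *m W *m K + Z = 0 ->
  hurwitz (A + B *m K).
Proof.
move=> pdW [G hG] psdP psdZ; set Ac := A + B *m K => eqnP z.
have AE : A = Ac - B *m K by rewrite addrK.
clearbody Ac.
rewrite -eigenvalue_tr map_trmx => /eigenvalueP[w wA w0].
rewrite real_ltNge ?num_real//; apply/negP => Rez_ge0.
have wAT : cmx Ac *m w^t* = z^* *: w^t*.
  by rewrite -[Ac]trmxK -trmxC_cmx -trmxC_mul wA linearZ/= map_mxZ.
have := congr1 (fun X => hform (cmx X) w) eqnP.
have -> : S^T *m S = S^T *m 1%:M *m S by rewrite mulmx1.
rewrite !map_mxD !hformD !hform_congr.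
have -> : hform (cmx (Ac^T *m P)) w + hform (cmx (P *m Ac)) w =
    (z + z^*) * hform (cmx P) w.
  rewrite /hform !map_mxM !mulmxA wA -[_ *m cmx Ac *m _]mulmxA wAT.
  by rewrite -!scalemxAl -scalemxAr mulrDl !mxE.
have -> : hform (cmx (0 : 'M[R]_n)) w = 0.
  by rewrite map_mx0 /hform mulmx0 mul0mx mxE.
move=> /eqP.
have zP_ge0 : 0 <= (z + z^*) * hform (cmx P) w.
  rewrite mulr_ge0 ?psd_hform_ge0// [z^*]/(conjc z) addcJ mulr_ge0 ?ler0n//.
  by rewrite ler0c.
have psdW := pdmx_psd pdW; have psd1 := pdmx_psd (pdmx1 p).
rewrite paddr_eq0 ?psd_hform_ge0 ?addr_ge0 ?psd_hform_ge0// => /andP[+ _].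
rewrite paddr_eq0 ?psd_hform_ge0 ?addr_ge0 ?psd_hform_ge0//.
move=> /andP[+ /eqP/(pd_hform_eq0 pdW) wK].
rewrite paddr_eq0 ?psd_hform_ge0//.
move=> /andP[_ /eqP/(pd_hform_eq0 (pdmx1 p)) wS].
have : complex.Re z < 0.
  apply: hG; rewrite -eigenvalue_tr map_trmx; apply/eigenvalueP.
  exists w => //; rewrite AE !linearD linearN/= !trmx_mul.
  rewrite !map_mxD map_mxN !map_mxM !mulmxDr mulmxN !mulmxA.
  by rewrite wK wS !mul0mx subr0 addr0 wA.
by rewrite ltNge Rez_ge0.
Qed.

End RealMatrices.

(** * Entrywise convergence of matrix sequences *)

Section EntrywiseConvergence.

Set Implicit Arguments.
Unset Strict Implicit.
Unset Printing Implicit Defensive.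

Variable R : realType.

Definition mxcvg m n (P : nat -> 'M[R]_(m, n)) (L : 'M[R]_(m, n)) :=
  forall i j, (fun k => P k i j) @ \oo --> L i j.

Lemma mxcvg_cvg m n (P : nat -> 'M[R]_(m, n)) L : mxcvg P L -> P @ \oo --> L.
Proof.
move=> PL; apply/cvg_mx_entourageP => E entE.
have h i j : \forall k \near \oo, (L i j, P k i j) \in E.
  have /cvg_entourageP/(_ E entE) := PL i j.
  by rewrite near_simpl; apply: filterS => k; rewrite inE.
have : \forall k \near \oo,
    forall ij : 'I_m * 'I_n, (L ij.1 ij.2, P k ij.1 ij.2) \in E.
  by apply: filter_forall => ij; exact: h.
by apply: filterS => k hk i j; exact: (hk (i, j)).
Qed.

Lemma mxcvg_cst m n (A : 'M[R]_(m, n)) : mxcvg (fun=> A) A.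
Proof. by move=> i j; exact: cvg_cst. Qed.

Lemma mxcvgD m n (P1 P2 : nat -> 'M[R]_(m, n)) L1 L2 :
  mxcvg P1 L1 -> mxcvg P2 L2 -> mxcvg (fun k => P1 k + P2 k) (L1 + L2).
Proof.
move=> h1 h2 i j; rewrite mxE; under eq_fun do rewrite mxE.
exact: (cvgD (h1 i j) (h2 i j)).
Qed.

Lemma mxcvgN m n (P : nat -> 'M[R]_(m, n)) L :
  mxcvg P L -> mxcvg (fun k => - P k) (- L).
Proof.
move=> h i j; rewrite mxE; under eq_fun do rewrite mxE.
exact: (cvgN (h i j)).
Qed.

Lemma mxcvg_tr m n (P : nat -> 'M[R]_(m, n)) L :
  mxcvg P L -> mxcvg (fun k => (P k)^T) L^T.
Proof.
by move=> h i j; rewrite mxE; under eq_fun do rewrite mxE; exact: h.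
Qed.

Lemma cvg_sumr (I : Type) (r : seq I) (f : I -> nat -> R) (l : I -> R) :
  (forall i, f i @ \oo --> l i) ->
  (fun k => \sum_(i <- r) f i k) @ \oo --> \sum_(i <- r) l i.
Proof.
move=> fl; elim: r => [|i r IHr].
  have -> : (fun k => \sum_(i <- [::]) f i k) = (fun=> 0 : R).
    by apply/funext => k; rewrite big_nil.
  by rewrite big_nil; exact: cvg_cst.
have -> : (fun k => \sum_(j <- i :: r) f j k) =
    f i \+ (fun k => \sum_(j <- r) f j k).
  by apply/funext => k; rewrite big_cons.
by rewrite big_cons; exact: cvgD.
Qed.

Lemma mxcvgM m n p (P1 : nat -> 'M[R]_(m, n)) (P2 : nat -> 'M[R]_(n, p)) L1 L2 :
  mxcvg P1 L1 -> mxcvg P2 L2 -> mxcvg (fun k => P1 k *m P2 k) (L1 *m L2).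
Proof.
move=> h1 h2 i j; rewrite mxE; under eq_fun do rewrite mxE.
by apply: cvg_sumr => l; apply: cvgM; [exact: h1|exact: h2].
Qed.

Lemma mxcvg_uniq m n (P : nat -> 'M[R]_(m, n)) L1 L2 :
  mxcvg P L1 -> mxcvg P L2 -> L1 = L2.
Proof.
by move=> h1 h2; apply/matrixP => i j; exact: cvg_unique (h1 i j) (h2 i j).
Qed.

Lemma mxcvg_shift m n (P : nat -> 'M[R]_(m, n)) L :
  mxcvg (fun k => P k.+1) L <-> mxcvg P L.
Proof.
by split=> h i j; have := h i j; rewrite -(cvg_shiftS (fun k => P k i j)).
Qed.

(** By polarization the entries are combinations of finitely many values of the
    quadratic form, whose convergence is easier to obtain. *)
Lemma symmx_entry n (X : 'M[R]_n) i j : X^T = X ->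
  let q x := (x^T *m X *m x) 0 0 in
  let e k : 'cV[R]_n := delta_mx k 0 in
  X i j = (q (e i + e j) - q (e i) - q (e j)) / 2.
Proof.
move=> symX q e.
have qE k l : ((e k)^T *m X *m e l) 0 0 = X k l.
  by rewrite /e trmx_delta -rowE -colE !mxE.
have symij : X j i = X i j by rewrite -{1}symX mxE.
rewrite /q [(_ + _)^T]raddfD /= mulmxDl mulmxDr !mulmxDl !addmxE !qE symij.
by field.
Qed.

(** Each quadratic form x^T P_k x is nonincreasing and nonnegative, hence
    convergent; by polarization the entries of P_k converge too. *)
Lemma psd_nonincreasing_cvg n (P : nat -> 'M[R]_n) :
  (forall k, psdmx (P k)) -> (forall k, psdmx (P k - P k.+1)) ->
  exists2 L, psdmx L & mxcvg P L.
Proof.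
move=> psdP decP; pose q k (x : 'cV[R]_n) := (x^T *m P k *m x) 0 0.
have cvgq x : cvgn (q ^~ x).
  apply: nonincreasing_is_cvgn.
    apply/nonincreasing_seqP => k; rewrite -subr_ge0.
    by have := (decP k).2 x; rewrite mulmxBr mulmxBl addmxE oppmxE.
  by exists 0 => _ [k _ <-]; exact: (psdP k).2.
pose e k : 'cV[R]_n := delta_mx k 0.
pose lq x := limn (q ^~ x).
pose L : 'M[R]_n := \matrix_(i, j) ((lq (e i + e j) - lq (e i) - lq (e j)) / 2).
have cvgP : mxcvg P L.
  move=> i j; rewrite mxE; under eq_fun do rewrite (symmx_entry _ _ (psdP _).1).
  by apply: cvgMl; apply: cvgB; [apply: cvgB|]; exact: cvgq.
exists L => //; split.
  by apply: (mxcvg_uniq (mxcvg_tr cvgP)); under eq_fun do rewrite (psdP _).1.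
move=> x.
have := mxcvgM (mxcvgM (@mxcvg_cst _ _ x^T) cvgP) (@mxcvg_cst _ _ x).
by move=> /(_ 0 0)/cvgr_to_ge; apply; apply: nearW => k; exact: (psdP k).2.
Qed.

End EntrywiseConvergence.

(** * Kleinman's algorithm *)

Section Kleinman.

Set Implicit Arguments.
Unset Strict Implicit.
Unset Printing Implicit Defensive.

Variable R : realType.

Lemma completing_square n m (A : 'M[R]_n) (B : 'M[R]_(n, m)) (W : 'M[R]_m)
    (P : 'M[R]_n) (K : 'M[R]_(m, n)) (K' := lqr_gain B W P) :
  pdmx W -> P^T = P ->
  (A + B *m K)^T *m P + P *m (A + B *m K) + K^T *m W *m K =
  (A + B *m K')^T *m P + P *m (A + B *m K') + K'^T *m W *m K'
  + (K - K')^T *m W *m (K - K').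
Proof.
move=> pdW symP.
have WK : W *m K' = - (B^T *m P).
  by rewrite /K' /lqr_gain mulmxN !mulmxA mulmxV ?pdmx_unit// mul1mx.
have KW : K'^T *m W = - (P *m B).
  by rewrite -[LHS]trmxK trmx_mul trmxK pdW.1 WK linearN/= trmx_mul trmxK symP.
have PBK : P *m (B *m K') = K'^T *m (B^T *m P).
  by rewrite mulmxA -[P *m B]opprK -KW mulNmx -mulmxA WK mulmxN opprK.
(* From here on only the three relations above matter; expanding both sides
   modulo them leaves an identity in the additive group of matrices. *)
clearbody K'.
rewrite ![(_ + _)^T]raddfD /= ![(- _)^T]raddfN /= !trmx_mul.
rewrite !(mulmxDl, mulmxDr, mulNmx, mulmxN) opprK -!mulmxA WK.
rewrite [K'^T *m (W *m K)]mulmxA KW !(mulNmx, mulmxN) -!mulmxA PBK.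
by apply/matrixP => i j; rewrite !(addmxE, oppmxE); ring.
Qed.

(** [completing_square] for the zero gain: it trades the open-loop expression of
    the Riccati equation for a Lyapunov equation along the closed loop. *)
Lemma riccati_lyapunovE n m (A : 'M[R]_n) (B : 'M[R]_(n, m)) (Q : 'M[R]_n)
    (W : 'M[R]_m) (P : 'M[R]_n) (K := lqr_gain B W P) :
  pdmx W -> P^T = P ->
  (A + B *m K)^T *m P + P *m (A + B *m K) + Q + K^T *m W *m K =
  A^T *m P + P *m A + Q - P *m B *m invmx W *m B^T *m P.
Proof.
move=> pdW symP; have := completing_square A B 0 pdW symP.
rewrite mulmx0 addr0 sub0r mulmx0 addr0 -/K.
have -> : P *m B *m invmx W *m B^T *m P = K^T *m W *m K.
  rewrite /K /lqr_gain [(- _)^T]raddfN /= !mulNmx !mulmxN opprK !trmx_mul.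
  by rewrite trmx_inv pdW.1 symP trmxK !mulmxA mulmxKV ?pdmx_unit.
clearbody K; rewrite [(- K)^T]raddfN /= !mulNmx mulmxN opprK => ->.
by apply/matrixP => i j; rewrite !(addmxE, oppmxE); ring.
Qed.

(** Subtracting the two Riccati equations and factoring the quadratic terms
    gives A1^T (P1 - P2) + (P1 - P2) A2 = 0, where A1 and A2 are the two closed
    loops. *)
Lemma stabilizing_riccati_uniq n m (A : 'M[R]_n) (B : 'M[R]_(n, m))
    (Q : 'M[R]_n) (W : 'M[R]_m) (P1 P2 : 'M[R]_n) :
  pdmx W -> P1^T = P1 -> P2^T = P2 ->
  riccati A B Q W P1 -> riccati A B Q W P2 ->
  hurwitz (A + B *m lqr_gain B W P1) -> hurwitz (A + B *m lqr_gain B W P2) ->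
  P1 = P2.
Proof.
move=> pdW sym1 sym2 ric1 ric2 h1 h2; apply/eqP; rewrite -subr_eq0; apply/eqP.
apply: (sylvester_eq0 h1 h2).
transitivity ((A^T *m P1 + P1 *m A + Q - P1 *m B *m invmx W *m B^T *m P1) -
  (A^T *m P2 + P2 *m A + Q - P2 *m B *m invmx W *m B^T *m P2)); last first.
  by rewrite ric1 ric2 subrr.
rewrite /lqr_gain [(_ + _)^T]raddfD /= mulmxN [(- _)^T]raddfN /= !trmx_mul.
rewrite trmx_inv pdW.1 sym1 trmxK.
rewrite !(mulmxBr, mulmxBl, mulmxDr, mulmxDl, mulmxN, mulNmx) !mulmxA.
by apply/matrixP => i j; rewrite !(addmxE, oppmxE); ring.
Qed.

Theorem kleinman_cvg n m p (A : 'M[R]_n) (B : 'M[R]_(n, m)) (S : 'M[R]_(p, n))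
    (W : 'M[R]_m) (Pstar : 'M[R]_n) (P : nat -> 'M[R]_n)
    (K : nat -> 'M[R]_(m, n)) :
  pdmx W -> detectable A S ->
  psdmx Pstar -> riccati A B (S^T *m S) W Pstar ->
  hurwitz (A + B *m K 0%N) -> kleinman A B (S^T *m S) W P K ->
  [/\ forall k, hurwitz (A + B *m K k),
      mxcvg P Pstar & mxcvg K (lqr_gain B W Pstar)].
Proof.
move=> pdW detS psdPs ricPs hur0 kle.
have psdW := pdmx_psd pdW.
have psdQ : psdmx (S^T *m S).
  by have := psdmx_congr S (pdmx_psd (pdmx1 R p)); rewrite mulmx1.
have psd0 : psdmx (0 : 'M[R]_n).
  by split=> [|x]; rewrite ?trmx0// mulmx0 mul0mx mxE.
have lyap k : (A + B *m K k)^T *m P k + P k *m (A + B *m K k)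
    + S^T *m S + (K k)^T *m W *m K k = 0 by have [<-] := kle k.
have gainE k : K k.+1 = lqr_gain B W (P k) by have [] := kle k.
have psdPk k : hurwitz (A + B *m K k) -> psdmx (P k).
  move=> hk; apply: (lyapunov_psd hk (psdmxD psdQ (psdmx_congr (K k) psdW))).
  by rewrite addrA lyap.
(* The equation of P_k, rewritten along the closed loop of the next gain. *)
have step k : psdmx (P k) ->
    (A + B *m K k.+1)^T *m P k + P k *m (A + B *m K k.+1) + S^T *m S
    + (K k.+1)^T *m W *m K k.+1
    + (K k - K k.+1)^T *m W *m (K k - K k.+1) = 0.
  move=> [symP _]; rewrite -[RHS](lyap k) ![_ + S^T *m S + _]addrAC.
  by rewrite (completing_square A B (K k) pdW symP) -gainE addrAC.
have hur k : hurwitz (A + B *m K k).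
  elim: k => [|k /psdPk psdP]; first exact: hur0.
  apply: (detectable_hurwitz pdW detS psdP (psdmx_congr (K k - K k.+1) psdW)).
  exact: step.
have psdP k := psdPk k (hur k).
have decP k : psdmx (P k - P k.+1).
  apply: (lyapunov_psd (hur k.+1) (psdmx_congr (K k - K k.+1) psdW)).
  rewrite -[RHS](subr0 0) -{2}(lyap k.+1) -(step k (psdP k)) mulmxBr mulmxBl.
  by apply/matrixP => i j; rewrite !(addmxE, oppmxE); ring.
have [L psdL cvgP] := psd_nonincreasing_cvg psdP decP.
have cvgK : mxcvg K (lqr_gain B W L).
  apply/mxcvg_shift; under eq_fun do rewrite gainE.
  exact/mxcvgN/mxcvgM/cvgP/mxcvg_cst.
have cvgA : mxcvg (fun k => A + B *m K k) (A + B *m lqr_gain B W L).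
  by apply: mxcvgD; [exact: mxcvg_cst|apply: mxcvgM => //; exact: mxcvg_cst].
have lyapL : (A + B *m lqr_gain B W L)^T *m L + L *m (A + B *m lqr_gain B W L)
    + S^T *m S + (lqr_gain B W L)^T *m W *m lqr_gain B W L = 0.
  apply: (mxcvg_uniq (P := fun k => (A + B *m K k)^T *m P k
     + P k *m (A + B *m K k) + S^T *m S + (K k)^T *m W *m K k)); last first.
    by under eq_fun do rewrite lyap; exact: mxcvg_cst.
  apply: mxcvgD; last first.
    by apply: mxcvgM => //; apply: mxcvgM; [exact: mxcvg_tr|exact: mxcvg_cst].
  apply: mxcvgD; last exact: mxcvg_cst.
  by apply: mxcvgD; apply: mxcvgM => //; exact: mxcvg_tr.
have ricL : riccati A B (S^T *m S) W L.
  by rewrite /riccati -riccati_lyapunovE// psdL.1.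
have stab X : psdmx X -> riccati A B (S^T *m S) W X ->
    hurwitz (A + B *m lqr_gain B W X).
  move=> psdX ricX; apply: (detectable_hurwitz pdW detS psdX psd0).
  by rewrite addr0 riccati_lyapunovE// psdX.1.
have <- : L = Pstar.
  apply: (stabilizing_riccati_uniq pdW psdL.1 psdPs.1 ricL ricPs); exact: stab.
by split.
Qed.

End Kleinman.

Theorem theorem3 (R : realType) (n m p : nat)
    (A : 'M[R]_n) (B : 'M[R]_(n, m)) (C : 'M[R]_(p, n)) (L : 'M[R]_(n, p))
    (Qy sqrtQy : 'M[R]_p) (W : 'M[R]_m)
    (D : 'I_n -> 'M[R]_n)
    (Pstar : 'M[R]_((m + p) * n))
    (P : nat -> 'M[R]_((m + p) * n)) (K : nat -> 'M[R]_(m, (m + p) * n)) :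
  psdmx Qy ->
  is_psd_sqrt Qy sqrtQy ->
  pdmx W ->
  is_resolvent_coeffs A C L D ->
  let Az := Azeta A B C L D in
  let Bz := Bzeta R n m p in
  let Qz := Qzeta B C L D Qy in
  stabilizable Az Bz ->
  detectable Az (sqrtQy *m C *m Mmx B L D) ->
  psdmx Pstar ->
  riccati Az Bz Qz W Pstar ->
  hurwitz (Az + Bz *m K 0%N) ->
  kleinman Az Bz Qz W P K ->
  [/\ forall k : nat, hurwitz (Az + Bz *m K k),
      P @ \oo --> Pstar
    & K @ \oo --> lqr_gain Bz W Pstar].
Proof.
move=> _ [[symS _] SS] pdW _ Az Bz Qz _ det psdPs.
have -> : Qz = (sqrtQy *m C *m Mmx B L D)^T *m (sqrtQy *m C *m Mmx B L D).
  by rewrite /Qz /Qzeta !trmx_mul symS -SS !mulmxA.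
move=> ric hur0 kle.
have [hur cvgP cvgK] := kleinman_cvg pdW det psdPs ric hur0 kle.
by split=> //; exact: mxcvg_cvg.
Qed.
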